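(* Let $a_1,\dots,a_m\in\mathbb{R}^d$ and a convex polytope $\mathcal{P}\subseteq\mathbb{R}^d$ be fixed, let $\epsilon>0$ and $b_{\max}>0$, and for a database $D=\{b_i\}_{i=1}^m$ with $b_i\in\mathbb{R}$ let $f(x,D)=\max_{i=1,\dots,m}\{a_i^Tx+b_i\}$. The exponential mechanism $M_E$, which on input $D$ randomly outputs $\tilde{x}_{\mathrm{opt}}\in\mathcal{P}$ according to the probability density function $$\frac{\exp(-\epsilon f(\tilde{x}_{\mathrm{opt}},D)/(2b_{\max}))}{\int_{x\in\mathcal{P}}\exp(-\epsilon f(x,D)/(2b_{\max}))\,dx},$$ is $\epsilon$-differentially private.
   Context: A convex polytope here means a set defined by linear inequality constraints (it may be bounded or unbounded). The vectors $a_i$ and the set $\mathcal{P}$ are public and fixed; only the $b_i$ are private. Databases $D=\{b_i\}_{i=1}^m$ and $D'=\{b_i'\}_{i=1}^m$ are adjacent if and only if $\max_{i\in\{1,\dots,m\}}|b_i-b_i'|\le b_{\max}$. A randomized mechanism $M$ with values in $\mathcal{P}$ is $\epsilon$-differentially private if for all $\mathcal{R}\subseteq\mathcal{P}$ and all adjacent $D,D'$, $\mathbb{P}(M(D)\in\mathcal{R})\le e^{\epsilon}\,\mathbb{P}(M(D')\in\mathcal{R})$. *)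

(* Defs.v *)
From HB Require Import structures.
From mathcomp Require Import all_boot all_order all_algebra.
From mathcomp Require Import all_classical all_reals all_analysis.
From mathcomp Require Import measurable_realfun.

Set Implicit Arguments.
Unset Strict Implicit.
Unset Printing Implicit Defensive.
Import Order.TTheory GRing.Theory Num.Theory.

Local Open Scope classical_set_scope.
Local Open Scope ring_scope.

(* Vectors of R^n, with the product of the Borel sigma-algebras of the
   coordinates (hence the Borel sigma-algebra of R^n). *)
Notation rvec R n := (n.-tuple (measurableTypeR R)).

(* Image under (x, t) |-> x :: t of the product of the Lebesgue measure on R
   with a measure on R^n. *)
Section lebesgue_cons.
Context (R : realType) (n : nat).
Variable mu : {sigma_finite_measure set (rvec R n) -> \bar R}.

Definition cons_pair (p : measurableTypeR R * rvec R n) : rvec R n.+1 :=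
  [tuple of p.1 :: p.2].

Definition lebesgue_cons : set (rvec R n.+1) -> \bar R :=
  pushforward (lebesgue_measure \x mu)%E cons_pair.

Lemma measurable_cons_pair : measurable_fun [set: _] cons_pair.
Proof. by apply: measurable_cons. Qed.

Let lebesgue_cons0 : lebesgue_cons set0 = 0%E.
Proof. by rewrite /lebesgue_cons /pushforward preimage_set0 measure0. Qed.

Let lebesgue_cons_ge0 A : (0 <= lebesgue_cons A)%E.
Proof. by rewrite /lebesgue_cons /pushforward measure_ge0. Qed.

Let lebesgue_cons_sigma_additive : semi_sigma_additive lebesgue_cons.
Proof.
move=> F mF tF mUF; rewrite /lebesgue_cons /pushforward preimage_bigcup.
apply: measure_semi_sigma_additive.
- by move=> i; rewrite -[X in measurable X]setTI; exact: measurable_cons_pair.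
- apply/trivIsetP => /= i j _ _ ij; rewrite -preimage_setI.
  by move/trivIsetP : tF => /(_ _ _ _ _ ij) ->//; rewrite preimage_set0.
- rewrite -preimage_bigcup -[X in measurable X]setTI.
  exact: measurable_cons_pair.
Qed.

HB.instance Definition _ := isMeasure.Build _ _ _ lebesgue_cons
  lebesgue_cons0 lebesgue_cons_ge0 lebesgue_cons_sigma_additive.

Let lebesgue_cons_sigma_finite : sigma_finite setT lebesgue_cons.
Proof.
have /sigma_finiteP[F [TF ndF Foo]] := sigma_finiteT (@lebesgue_measure R).
have /sigma_finiteP[G [TG ndG Goo]] := sigma_finiteT mu.
exists (fun k => [set t : rvec R n.+1 |
    F k (thead t) /\ G k [tuple of behead t]]).
  apply/seteqP; split => // t _ /=.
  have [i _ Fi] : (\bigcup_i F i) (thead t) by rewrite -TF.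
  have [j _ Gj] : (\bigcup_i G i) [tuple of behead t] by rewrite -TG.
  exists (maxn i j) => //; split.
    by move: Fi; exact/subsetPset/ndF/leq_maxl.
  by move: Gj; exact/subsetPset/ndG/leq_maxr.
move=> k; have [mF Fk] := Foo k; have [mG Gk] := Goo k; split.
  apply: measurableI; rewrite -[X in measurable X]setTI.
    by apply: (measurable_tnth ord0 _ mF).
  by apply: (@measurable_behead _ _ n _ _ mG).
rewrite /lebesgue_cons /pushforward (_ : _ @^-1` _ = F k `*` G k).
  by rewrite product_measure1E// lte_mul_pinfty// ge0_fin_numE.
apply/seteqP; split => -[x t] /=; rewrite (_ : [tuple of _] = t)//;
  exact/val_inj.
Qed.

HB.instance Definition _ := Measure_isSigmaFinite.Build _ _ _ lebesgue_cons
  lebesgue_cons_sigma_finite.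

End lebesgue_cons.

(* n-dimensional Lebesgue measure on R^n (on the Borel sets), as an iterated
   product measure; lebesgue_rvec_box below characterizes it. *)
Fixpoint lebesgue_rvec (R : realType) (n : nat) :
    {sigma_finite_measure set (rvec R n) -> \bar R} :=
  match n with
  | 0 => dirac ([tuple] : rvec R 0)
  | n'.+1 => lebesgue_cons (lebesgue_rvec R n')
  end.

Lemma lebesgue_rvec_box (R : realType) (n : nat)
    (A : 'I_n -> set (measurableTypeR R)) :
  (forall i, measurable (A i)) ->
  lebesgue_rvec R n [set x | forall i, A i (tnth x i)] =
  (\prod_(i < n) lebesgue_measure (A i))%E.
Proof.
elim: n A => [|n IH] A mA.
  rewrite big_ord0 /= diracE mem_set//= => i; by case: i.
rewrite big_ord_recl /= /lebesgue_cons /pushforward.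
rewrite (_ : _ @^-1` _ =
    A ord0 `*` [set x | forall i, A (lift ord0 i) (tnth x i)]); last first.
  apply/seteqP; split => [[x t] /= At|[x t] /= [Ax At] i].
    split; first exact: (At ord0).
    by move=> i; have := At (lift ord0 i); rewrite tnthS.
  have [j ->|->//] := unliftP ord0 i.
  by rewrite tnthS.
rewrite product_measure1E//; first by congr (_ * _)%E; apply: IH.
rewrite (_ : [set _ | _] =
   \bigcap_(i in [set: 'I_n]) ((fun x => tnth x i) @^-1` A (lift ord0 i))).
  apply: fin_bigcap_measurable => // i _.
  by rewrite -[X in measurable X]setTI; exact: measurable_tnth.
by apply/seteqP; split => x /= h i => [_|]; exact: h.
Qed.

Definition dotp (R : realType) (n : nat) (a x : rvec R n) : R :=
  \sum_(i < n) tnth a i * tnth x i.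

Definition convex_polytope (R : realType) (n : nat) (P : set (rvec R n)) : Prop :=
  exists (k : nat) (c : 'I_k -> rvec R n) (h : 'I_k -> R),
    P = [set x | forall j, dotp (c j) x <= h j].

(* A randomized mechanism sends a database to the law of its output; events are
   the measurable subsets of P. *)
Definition differentially_private (R : realType) (d : measure_display)
    (T : measurableType d) (DB : Type) (adjacent : DB -> DB -> Prop)
    (P : set T) (eps : R) (M : DB -> probability T R) : Prop :=
  forall A : set T, measurable A -> A `<=` P ->
  forall D D' : DB, adjacent D D' ->
  (M D A <= (expR eps)%:E * M D' A)%E.

Definition has_density (R : realType) (d : measure_display)
    (T : measurableType d) (mu : {measure set T -> \bar R}) (P : set T)
    (p : T -> R) (Q : probability T R) : Prop :=
  forall A : set T, measurable A ->
  Q A = (\int[mu]_(x in A `&` P) (p x)%:E)%E.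

(* There are m.+1 >= 1 affine pieces, so that the maximum is over a nonempty
   index set. *)
Section exponential_mechanism.
Context (R : realType) (m n : nat).

Definition database := 'I_m.+1 -> R.

Definition adjacent_db (bmax : R) (D D' : database) : Prop :=
  \big[Num.max/`|D ord0 - D' ord0|]_(i < m.+1) `|D i - D' i| <= bmax.

Variables (a : 'I_m.+1 -> rvec R n) (P : set (rvec R n)) (eps bmax : R).

Definition max_affine (x : rvec R n) (D : database) : R :=
  \big[Num.max/dotp (a ord0) x + D ord0]_(i < m.+1) (dotp (a i) x + D i).

Definition exp_weight (D : database) (x : rvec R n) : R :=
  expR (- eps * max_affine x D / (2 * bmax)).

(* The real-valued integral is 0 when the extended one is +oo; in that case, as
   when the integral is 0, x / 0 = 0 makes the quotient vanish, and no
   probability measure has this density. *)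
Definition exp_density (D : database) (x : rvec R n) : R :=
  exp_weight D x / \int[lebesgue_rvec R n]_(y in P) exp_weight D y.

Definition exponential_mechanism (M : database -> probability (rvec R n) R) : Prop :=
  forall D, has_density (lebesgue_rvec R n) P (exp_density D) (M D).

End exponential_mechanism.

Lemma measurable_dotp (R : realType) (n : nat) (a : rvec R n) :
  measurable_fun [set: rvec R n] (dotp a).
Proof.
apply: measurable_sum => i; apply: measurable_funM => //.
exact: measurable_tnth.
Qed.

Lemma measurable_polytope (R : realType) (n : nat) (P : set (rvec R n)) :
  convex_polytope P -> measurable P.
Proof.
move=> [k [c [h ->]]].
rewrite (_ : [set _ | _] =
    \bigcap_(j in [set: 'I_k]) (dotp (c j) @^-1` `]-oo, h j]%classic)).
  apply: fin_bigcap_measurable => // j _.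
  by rewrite -[X in measurable X]setTI; apply: measurable_dotp.
apply/seteqP; split => x /= Px j => [_|]; first by have := Px j.
by have := Px j I.
Qed.

Section exponential_mechanism_exists.
Context (R : realType) (m n : nat).
Variables (a : 'I_m.+1 -> rvec R n) (P : set (rvec R n)) (eps bmax : R).

Lemma measurable_max_affine (D : database R m) :
  measurable_fun [set: rvec R n] (fun x => max_affine a x D).
Proof.
rewrite /max_affine; elim: (index_enum _) => [|i s IH].
  under eq_fun do rewrite big_nil.
  by apply: measurable_funD => //; exact: measurable_dotp.
under eq_fun do rewrite big_cons.
apply: measurable_maxr => //.
by apply: measurable_funD => //; exact: measurable_dotp.
Qed.

Lemma measurable_exp_weight (D : database R m) :
  measurable_fun [set: rvec R n] (exp_weight a eps bmax D).
Proof.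
apply: measurableT_comp => //; apply: measurable_funM => //.
by apply: measurable_funM => //; exact: measurable_max_affine.
Qed.

Lemma exponential_mechanism_exists : convex_polytope P ->
  (forall D : database R m,
    0 < \int[lebesgue_rvec R n]_(x in P) (exp_weight a eps bmax D x)%:E
      < +oo)%E ->
  exists M, exponential_mechanism a P eps bmax M.
Proof.
move=> polP Z; have mP := measurable_polytope polP.
suff Q D : exists Q, has_density (lebesgue_rvec R n) P
    (exp_density a P eps bmax D) Q.
  by exists (fun D => projT1 (cid (Q D))) => D; exact: projT2 (cid (Q D)).
pose p := exp_density a P eps bmax D.
pose q (A : set (rvec R n)) :=
  (\int[lebesgue_rvec R n]_(x in A `&` P) (p x)%:E)%E.
have /andP[Z0 Zoo] := Z D.
have w0 x : 0 <= exp_weight a eps bmax D x by exact: expR_ge0.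
have p0 x : (0 <= (p x)%:E)%E.
  by rewrite lee_fin divr_ge0// Rintegral_ge0.
have mp : measurable_fun [set: rvec R n] (EFin \o p).
  apply/measurable_EFinP; apply: measurable_funM => //.
  exact: measurable_exp_weight.
have q0 : q set0 = 0%E by rewrite /q set0I integral_set0.
have q_ge0 A : (0 <= q A)%E by apply: integral_ge0.
have q_sigma : semi_sigma_additive q.
  move=> F mF tF mUF; rewrite /q setI_bigcupl ge0_integral_bigcup//.
  - by apply: is_cvg_ereal_nneg_natsum_cond => k _ _; exact: q_ge0.
  - by move=> k; exact: measurableI.
  - exact: measurable_funS mp.
  - exact: trivIset_setIr.
have qT : q setT = 1%E.
  rewrite /q setTI /p /exp_density.
  under eq_integral do rewrite mulrC EFinM.
  rewrite ge0_integralZl//; last 3 first.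
  - apply: measurable_funTS; apply/measurable_EFinP.
    exact: measurable_exp_weight.
  - by move=> x _; rewrite lee_fin.
  - by rewrite lee_fin invr_ge0 Rintegral_ge0.
  rewrite /Rintegral; move: Z0 Zoo; case: (integral _ _ _) => //= r r0 _.
  by rewrite -EFinM mulVf// gt_eqF.
pose qm := isMeasure.Build _ _ _ q q0 q_ge0 q_sigma.
pose qM : {measure set _ -> \bar R} := HB.pack q qm.
pose qp := Measure_isProbability.Build _ _ _ qM qT.
pose qP : probability (rvec R n) R := HB.pack q qm qp.
by exists qP.
Qed.

End exponential_mechanism_exists.

(* Main.v *)
Require Import Defs.
From mathcomp Require Import all_boot all_order all_algebra.
From mathcomp Require Import all_classical all_reals all_analysis.
From mathcomp Require Import measurable_realfun ring lra.

(** Changing every [b_i] by at most [bmax] changes the maximum of the affine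
    pieces by at most [bmax], hence the unnormalised weight by a factor of at
    most [exp (eps / 2)]. Integrating, the normalising constant also changes by
    a factor of at most [exp (eps / 2)], so the density changes by a factor of
    at most [exp eps]; integrate over the event. *)

Set Implicit Arguments.
Unset Strict Implicit.
Unset Printing Implicit Defensive.
Import Order.TTheory GRing.Theory Num.Theory.

Local Open Scope classical_set_scope.
Local Open Scope ring_scope.

Section exponential_mechanism_theory.
Context (R : realType) (m n : nat).
Implicit Types (a : 'I_m.+1 -> rvec R n) (P : set (rvec R n)).
Implicit Types (eps bmax : R) (D : database R m) (x : rvec R n).

Lemma adjacent_db_le bmax D D' i : adjacent_db bmax D D' ->
  `|D i - D' i| <= bmax.
Proof. by apply: le_trans; exact: le_bigmax. Qed.

Lemma adjacent_db_sym bmax D D' : adjacent_db bmax D D' ->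
  adjacent_db bmax D' D.
Proof.
move=> DD'; apply: bigmax_le => [|i _]; rewrite distrC; exact: adjacent_db_le.
Qed.

(** Pieces are compared index by index: the piece for [D] is at most [c] above the same piece for
    [D'], so no maximiser has to be chosen. *)
Lemma max_affine_leD a x D D' (c : R) : (forall i, D i <= D' i + c) ->
  max_affine a x D <= max_affine a x D' + c.
Proof.
move=> DD'; suff le_i i : dotp (a i) x + D i <= max_affine a x D' + c.
  by apply: bigmax_le => [|i _]; exact: le_i.
have : dotp (a i) x + D' i <= max_affine a x D'.
  exact: (le_bigmax _ (fun i => dotp (a i) x + D' i)).
by have := DD' i; lra.
Qed.

Lemma exp_weight_gt0 a eps bmax D x : 0 < exp_weight a eps bmax D x.
Proof. exact: expR_gt0. Qed.

Lemma exp_weight_adjacent a eps bmax D D' x : 0 <= eps -> 0 < bmax ->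
  adjacent_db bmax D D' ->
  exp_weight a eps bmax D x <= expR (eps / 2) * exp_weight a eps bmax D' x.
Proof.
move=> eps0 bmax0 DD'; rewrite /exp_weight -expRD ler_expR.
(* The weight decreases as the maximum grows, so here the maximum for [D'] is the one to bound from
   above. *)
have : max_affine a x D' <= max_affine a x D + bmax.
  apply: max_affine_leD => i; have := adjacent_db_le i DD'.
  by rewrite ler_norml => /andP[]; lra.
move: (max_affine _ _ D) (max_affine _ _ D') => u v uv.
rewrite -subr_ge0.
(* Writing [eps / 2] as [eps * bmax / (2 * bmax)] brings the shift [bmax] into a nonnegative
   numerator. *)
have -> : eps / 2 + - eps * v / (2 * bmax) - - eps * u / (2 * bmax) =
    eps * (u + bmax - v) / (2 * bmax) by field; rewrite gt_eqF.
by rewrite divr_ge0 ?mulr_ge0// ?subr_ge0// ltW.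
Qed.

Lemma measurable_exp_weightE a eps bmax D P :
  measurable_fun P (fun x => (exp_weight a eps bmax D x)%:E).
Proof.
by apply/measurable_EFinP; apply: measurable_funTS; exact: measurable_exp_weight.
Qed.

(* A null or infinite normalising constant would make the density vanish (by
   [x / 0 = 0]), contradicting that the law has total mass 1. *)
Lemma exp_density_normalizer_gt0 a P eps bmax D (Q : probability (rvec R n) R) :
  has_density (lebesgue_rvec R n) P (exp_density a P eps bmax D) Q ->
  0 < \int[lebesgue_rvec R n]_(x in P) exp_weight a eps bmax D x.
Proof.
move=> /(_ _ measurableT); rewrite probability_setT setTI => Q1.
rewrite lt0r Rintegral_ge0 ?andbT; last first.
  by move=> x _; exact/ltW/exp_weight_gt0.
apply/eqP => Z0; move: Q1; rewrite /exp_density Z0 integral0_eq.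
  by move/eqP; rewrite onee_eq0.
by move=> x _; rewrite invr0 mulr0.
Qed.

Lemma normalizer_adjacent a P eps bmax D D' : measurable P ->
  0 <= eps -> 0 < bmax -> adjacent_db bmax D D' ->
  0 < \int[lebesgue_rvec R n]_(x in P) exp_weight a eps bmax D' x ->
  \int[lebesgue_rvec R n]_(x in P) exp_weight a eps bmax D x <=
  expR (eps / 2) *
    \int[lebesgue_rvec R n]_(x in P) exp_weight a eps bmax D' x.
Proof.
move=> mP eps0 bmax0 DD'; rewrite /Rintegral.
have w0 D0 x : (0 <= (exp_weight a eps bmax D0 x)%:E)%E.
  by rewrite lee_fin ltW// exp_weight_gt0.
(* In the extended reals, monotonicity needs only nonnegativity and measurability, not
   integrability. *)
have : (\int[lebesgue_rvec R n]_(x in P) (exp_weight a eps bmax D x)%:E <=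
    (expR (eps / 2))%:E *
    \int[lebesgue_rvec R n]_(x in P) (exp_weight a eps bmax D' x)%:E)%E.
  rewrite -ge0_integralZl//; last exact: measurable_exp_weightE.
  apply: ge0_le_integral => //.
  - exact: measurable_exp_weightE.
  - by apply: measurable_funeM; exact: measurable_exp_weightE.
  - by move=> x _; rewrite -EFinM lee_fin exp_weight_adjacent.
have := integral_ge0 (lebesgue_rvec R n) (fun x (_ : P x) => w0 D x).
(* An infinite integral has real value 0, so the positivity hypothesis makes the integral for [D']
   finite; the inequality then makes the one for [D] finite. *)
case: (\int[_]_(_ in P) (exp_weight _ _ _ D _)%:E)%E => [z||]//;
  by case: (\int[_]_(_ in P) _)%E => [z'||]//=; rewrite ?ltxx.
Qed.

Lemma exp_density_adjacent a P eps bmax D D' x : measurable P ->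
  0 <= eps -> 0 < bmax -> adjacent_db bmax D D' ->
  0 < \int[lebesgue_rvec R n]_(x in P) exp_weight a eps bmax D x ->
  0 < \int[lebesgue_rvec R n]_(x in P) exp_weight a eps bmax D' x ->
  exp_density a P eps bmax D x <= expR eps * exp_density a P eps bmax D' x.
Proof.
move=> mP eps0 bmax0 DD' Z0 Z'0.
have wle := exp_weight_adjacent a x eps0 bmax0 DD'.
(* The normalisers are denominators, so they are compared with [D] and [D'] exchanged. *)
have Zle := normalizer_adjacent mP eps0 bmax0 (adjacent_db_sym DD') Z0.
rewrite /exp_density mulrA ler_pdivlMr// mulrAC ler_pdivrMr//.
(* One factor [expR (eps / 2)] pays for the weights, the other for the normalisers. *)
have -> : expR eps = expR (eps / 2) * expR (eps / 2).
  by rewrite -expRD -splitr.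
rewrite -(mulrA (expR _ * _)) mulrACA.
by apply: ler_pM => //; rewrite ltW// exp_weight_gt0.
Qed.

End exponential_mechanism_theory.

Theorem theorem19 (R : realType) (m n : nat) (a : 'I_m.+1 -> rvec R n)
    (P : set (rvec R n)) (eps bmax : R)
    (M : database R m -> probability (rvec R n) R) :
  convex_polytope P -> 0 < eps -> 0 < bmax ->
  exponential_mechanism a P eps bmax M ->
  differentially_private (adjacent_db bmax) P eps M.
Proof.
move=> polP eps0 bmax0 ME A mA AP D D' DD'.
have mP := measurable_polytope polP.
(* Positivity of every normaliser comes from each [M D0] being a probability measure. *)
have Z0 D0 := exp_density_normalizer_gt0 (ME D0).
have p0 D0 x : (0 <= (exp_density a P eps bmax D0 x)%:E)%E.
  by rewrite lee_fin divr_ge0// ltW// exp_weight_gt0.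
have mp D0 : measurable_fun (A `&` P)
    (fun x => (exp_density a P eps bmax D0 x)%:E).
  apply/measurable_EFinP; apply: measurable_funM => //.
  by apply: measurable_funTS; exact: measurable_exp_weight.
have mAP : measurable (A `&` P) by exact: measurableI.
rewrite !(ME _ _ mA) -ge0_integralZl//.
apply: ge0_le_integral => //.
- exact: measurable_funeM.
- move=> x _; rewrite -EFinM lee_fin.
  by apply: exp_density_adjacent => //; exact: ltW.
Qed.
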